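(* Let $\mathbf{P}\subset\mathbb{C}$ be a Jordan arc and let $(A,b)\in C_{n,n}(\mathbf{P})\times C_n(\mathbf{P})$ satisfy the following three conditions. (N1) The pair $(A(\theta),b(\theta))$ is reachable for every $\theta\in\mathbf{P}$. (N2) $\sigma(A(\theta))\cap\sigma(A(\theta'))=\emptyset$ for any pair of distinct parameters $\theta,\theta'\in\mathbf{P}$. (S1) For each $\theta\in\mathbf{P}$ the characteristic polynomial of $A(\theta)$ takes the form $z^n-(a_{n-1}z^{n-1}+\cdots+a_1z+a_0(\theta))$ for some $a_{n-1},\dots,a_1\in\mathbb{C}$ and $a_0\in C(\mathbf{P})$. Put $S(\theta)=\begin{pmatrix} b(\theta) & A(\theta)b(\theta)&\cdots& A(\theta)^{n-1}b(\theta)\end{pmatrix}$, which is invertible for every $\theta\in\mathbf{P}$ by (N1). Let $\varepsilon>0$, suppose that $f\in C_n(\mathbf{P})$ is such that $(S^{-1}f)_k\circ a_0^{-1}\in\operatorname{Lip}(a_0(\mathbf{P}))$ for all $k=1,\dots,n$, and assume that $a_0(\mathbf{P})=[\underline a,\overline a]$ is a compact real interval. Write $g_k:=(S^{-1}f)_k\circ a_0^{-1}$, let $L_k>0$ be a Lipschitz constant of $g_k$, let $M_{g_k}=\max_{z\in a_0(\mathbf{P})}|g_k(z)|$, and let $B_{g_k,n_k}$ be the Bernstein polynomial of $g_k$ on $[\underline a,\overline a]$ of degree $n_k\ge 3$, where $n_k$ satisfies $$\sqrt2\left(4M_{g_k}+\frac{(\overline a-\underline a)L_k}{2}\right)\sqrt{\frac{\log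 n_k}{n_k}}<\frac{\varepsilon}{\|S\|_{M,\infty}}.$$ Let $$p(z)=\sum_{k=1}^n B_{g_k,n_k}\big(z^n-a_{n-1}z^{n-1}-\cdots-a_1z\big)\,z^{k-1}=\sum_{l=0}^N\alpha_l z^l$$ be the monomial representation. Then, for $$T=N+1\qquad\text{and}\qquad u=(u_0,\dots,u_{T-1})=(\alpha_N,\dots,\alpha_0),$$ the solution of the discrete-time system $x_{t+1}(\theta)=A(\theta)x_t(\theta)+b(\theta)u_t$, $x_0(\theta)=0$, satisfies $$\|\varphi(T,u,0)-f\|_\infty<\varepsilon.$$ In particular, the result is true if $(A,b)\in C^1_{n,n}(\mathbf{P})\times C^1_n(\mathbf{P})$ and $f\in\operatorname{Lip}_n(\mathbf{P})$.
   Context: A Jordan arc is a homeomorphic image in $\mathbb{C}$ of a compact interval. $C_{n,m}(\mathbf{P})$ and $C_n(\mathbf{P})$ denote the continuous functions from $\mathbf{P}$ to $\mathbb{C}^{n\times m}$ and $\mathbb{C}^n$, and $C(\mathbf{P})=C_1(\mathbf{P})$; a superscript $1$ denotes the continuously differentiable ones. $\operatorname{Lip}_n(\Omega)$ is the set of functions $g\colon\Omega\to\mathbb{C}^n$ for which there is $L>0$ (a Lipschitz constant) with $\|g(z_1)-g(z_2)\|\le L|z_1-z_2|$ for all $z_1,z_2\in\Omega$, and $\operatorname{Lip}=\operatorname{Lip}_1$. $\sigma(\cdot)$ is the spectrum. A pair $(A,b)\in\mathbb{C}^{n\times n}\times\mathbb{C}^n$ is reachable if $b,Ab,\dots,A^{n-1}b$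 are linearly independent. By (N2) and (S1) the function $a_0$ is injective on $\mathbf{P}$, so $a_0^{-1}\colon a_0(\mathbf{P})\to\mathbf{P}$ is defined. $\|\cdot\|$ is the norm on $\mathbb{C}^n$, $\|g\|_\infty=\sup_{\theta\in\mathbf{P}}\|g(\theta)\|$, $\|\cdot\|_M$ is a matrix norm that is submultiplicative to $\|\cdot\|$, i.e. $\|Xv\|\le\|X\|_M\|v\|$, and $\|S\|_{M,\infty}=\sup_{\theta\in\mathbf{P}}\|S(\theta)\|_M$. $(S^{-1}f)_k$ denotes the $k$-th component of $\theta\mapsto S(\theta)^{-1}f(\theta)$. The inputs $u_t\in\mathbb{C}$ do not depend on $\theta$, and the solution at time $T$ is $\varphi(T,u,0)(\theta)=\sum_{k=0}^{T-1}A(\theta)^{T-1-k}b(\theta)u_k$. The $m$-th Bernstein polynomial of $g\colon[\underline a,\overline a]\to\mathbb{C}$ is $$B_{g,m}(x)=\frac{1}{(\overline a-\underline a)^m}\sum_{j=0}^m\binom{m}{j}\,g\big(\underline a+\tfrac jm(\overline a-\underline a)\big)(x-\underline a)^j(\overline a-x)^{m-j}.$$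
   Formalization: The norm on C^n is assumed to satisfy ‖v‖ ≤ max_k |v_k| (the claim fails e.g. for the Euclidean norm, n=64), and the ''in particular'' (C^1, Lip) sentence additionally assumes a_0'(θ) ≠ 0 on P (it fails for A(t)=t^3, f(t)=t); one-point arcs are excluded. *)

(* Defs.v *)
From HB Require Import structures.
From mathcomp Require Import all_boot all_order all_algebra.
From mathcomp Require Import all_classical all_reals all_analysis.
From mathcomp Require Import complex.

Set Implicit Arguments.
Unset Strict Implicit.
Unset Printing Implicit Defensive.

Import Order.TTheory GRing.Theory Num.Theory numFieldNormedType.Exports.

Local Open Scope classical_set_scope.
Local Open Scope ring_scope.
Local Open Scope complex_scope.

(* The usual topology and norm of the complex plane, as a module over itself:
   the library provides them on R[i]^o only. *)
HB.instance Definition _ (R : realType) := NormedModule.copy R[i] R[i]^o.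

(* The modulus with values in R; the library's `|z| is valued in R[i]. *)
Notation normc := (@ComplexField.Normc.normc _).

Definition jordan_arc (R : realType) (P : set R[i]) : Prop :=
  exists (c d : R) (h : R -> R[i]) (h' : R[i] -> R),
    [/\ c < d, h @` `[c, d] = P, {in `[c, d], cancel h h'},
        {within `[c, d], continuous h} & {within P, continuous h'}].

Definition is_norm (R : realType) (V : lmodType R[i]) (N : V -> R) : Prop :=
  [/\ forall u v, N (u + v) <= N u + N v,
      forall (c : R[i]) v, N (c *: v) = normc c * N v
    & forall v, N v = 0 -> v = 0].

(* [sup] is taken in R, so it is 0 by convention for an unbounded set; it is
   used below for continuous functions on compact sets only. *)
Definition sup_norm (R : realType) (T V : Type) (N : V -> R) (X : set T)
    (g : T -> V) : R :=
  sup [set N (g x) | x in X].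

Definition lipschitz_with (R : realType) (V : zmodType) (N : V -> R)
    (X : set R[i]) (g : R[i] -> V) (L : R) : Prop :=
  forall z1 z2, X z1 -> X z2 -> N (g z1 - g z2) <= L * normc (z1 - z2).

Definition Lip (R : realType) (V : zmodType) (N : V -> R)
    (X : set R[i]) (g : R[i] -> V) : Prop :=
  exists2 L : R, 0 < L & lipschitz_with N X g L.

(* Derivative along P: the difference quotient is taken at points of P only. *)
Definition has_derivative_on (R : realType) (V : normedModType R[i])
    (P : set R[i]) (g : R[i] -> V) (z : R[i]) (d : V) : Prop :=
  (w - z)^-1 *: (g w - g z) @[w --> within (P `\ z) (nbhs z)] --> d.

Definition C1_on (R : realType) (V : normedModType R[i])
    (P : set R[i]) (g : R[i] -> V) : Prop :=
  exists2 g' : R[i] -> V, {within P, continuous g'} &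
    forall z, P z -> has_derivative_on P g z (g' z).

Definition spectrum (R : realType) (n : nat) (M : 'M[R[i]]_n) : set R[i] :=
  [set z | eigenvalue M z].

Definition reachable (R : realType) (n : nat) (M : 'M[R[i]]_n)
    (v : 'cV[R[i]]_n) : Prop :=
  free [tuple M ^+ j *m v | j < n].

Definition reachability_mx (R : realType) (n : nat) (M : 'M[R[i]]_n)
    (v : 'cV[R[i]]_n) : 'M[R[i]]_n :=
  \matrix_(i, j) (M ^+ j *m v) i ord0.

Fixpoint solution (R : realType) (n : nat) (A : R[i] -> 'M[R[i]]_n)
    (b : R[i] -> 'cV[R[i]]_n) (t : nat) (u : nat -> R[i])
    (x0 : R[i] -> 'cV[R[i]]_n) (theta : R[i]) : 'cV[R[i]]_n :=
  if t is s.+1 then A theta *m solution A b s u x0 theta + u s *: b theta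
  else x0 theta.

Lemma solutionE (R : realType) (n : nat) (A : R[i] -> 'M[R[i]]_n)
    (b : R[i] -> 'cV[R[i]]_n) (T : nat) (u : nat -> R[i]) (theta : R[i]) :
  solution A b T u (fun=> 0) theta =
  \sum_(k < T) u k *: (A theta ^+ (T.-1 - k) *m b theta).
Proof.
elim: T => [|T IH] /=; first by rewrite big_ord0.
rewrite IH big_ord_recr /= subnn expr0 mul1mx mulmx_sumr; congr (_ + _).
apply: eq_bigr => k _; rewrite -scalemxAr mulmxA; congr (_ *: (_ *m _)).
rewrite (_ : (T - k = (T.-1 - k).+1)%N) ?exprS //.
by case: T k {IH} => [[]//|T] k /=; rewrite subSn // -ltnS.
Qed.

Definition bernstein (R : realType) (al ar : R) (g : R -> R[i]) (m : nat) :
    {poly R[i]} :=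
  ((ar - al)%:C ^+ m)^-1 *:
    \sum_(j < m.+1)
      ('C(m, j)%:R * g (al + j%:R / m%:R * (ar - al))) *:
        (('X - (al%:C)%:P) ^+ j * ((ar%:C)%:P - 'X) ^+ (m - j)).

(* Main.v *)
(* By Cayley-Hamilton the polynomial z^n - a_{n-1} z^{n-1} - ... - a_1 z sends
   A(theta) to the scalar matrix a_0(theta), so p(A(theta)) b(theta) is S(theta)
   applied to the vector of the B_k(a_0(theta)), while f(theta) is S(theta)
   applied to the vector of the g_k(a_0(theta)). It remains to estimate B_k - g_k:
   for a Lipschitz function on an interval of length D, the binomial variance
   t(1-t)/m bounds the error by D L / (2 sqrt m), which is below the required
   rate because ln m >= 1/2.

   For the last claim, a_0 = +-det A is C^1 along the arc. Pulled back to the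
   parameter interval of the arc, a_0 is strictly monotone, and every C^1
   function has increments locally dominated by those of a_0 because a_0' does
   not vanish; a supremum argument makes the domination global. Bounded functions
   with increments dominated by those of a_0 form a ring, which contains the
   entries of S, det S, 1 / det S and f, hence those of S^-1 f. *)

Require Import Defs.
From HB Require Import structures.
From mathcomp Require Import all_boot all_order all_algebra.
From mathcomp Require Import all_classical all_reals all_analysis.
From mathcomp Require Import complex.
From mathcomp Require Import ring lra.

Set Implicit Arguments.
Unset Strict Implicit.

Import Order.TTheory GRing.Theory Num.Theory numFieldNormedType.Exports.

Local Open Scope classical_set_scope.
Local Open Scope ring_scope.
Local Open Scope complex_scope.

(** * Bernstein approximation of Lipschitz functions *)

Lemma normcE (R : realType) (z : R[i]) : `|z| = (normc z)%:C.
Proof. by case: z. Qed.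

Lemma normc_ge0 (R : realType) (z : R[i]) : 0 <= normc z.
Proof. by case: z => x y; exact: sqrtr_ge0. Qed.

Lemma normc_le_add (R : realType) (z w : R[i]) :
  normc (z + w) <= normc z + normc w.
Proof. by rewrite -lecR rmorphD /= -!normcE; exact: ler_normD. Qed.

Lemma normc_opp (R : realType) (z : R[i]) : normc (- z) = normc z.
Proof. by case: z => x y /=; rewrite !sqrrN. Qed.

Lemma normc_subC (R : realType) (z w : R[i]) : normc (z - w) = normc (w - z).
Proof. by rewrite -normc_opp opprB. Qed.

Lemma normc_real (R : realType) (x : R) : normc x%:C = `|x|.
Proof. by rewrite /= expr0n addr0 sqrtr_sqr. Qed.

Lemma normc_eq0 (R : realType) (z : R[i]) : (normc z == 0) = (z == 0).
Proof.
apply/eqP/eqP => [|->]; first exact: ComplexField.Normc.eq0_normc.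
exact: ComplexField.Normc.normc0.
Qed.

Lemma normc_gt0 (R : realType) (z : R[i]) : (0 < normc z) = (z != 0).
Proof. by rewrite lt0r normc_eq0 normc_ge0 andbT. Qed.

Lemma normc_sum (R : realType) (I : finType) (F : I -> R[i]) :
  normc (\sum_i F i) <= \sum_i normc (F i).
Proof.
elim/big_ind2: _ => [|x1 x2 y1 y2 h1 h2|//].
  by rewrite ComplexField.Normc.normc0.
by rewrite (le_trans (normc_le_add _ _)) ?lerD.
Qed.

(** Pascal's rule, read as conditioning on the first of m+1 trials: a success, of weight t, shifts
    the argument of [phi] by one. *)
Lemma binomial_mean_recr (R : comNzRingType) (t s : R) (phi : nat -> R) m :
  \sum_(j < m.+2) 'C(m.+1, j)%:R * t ^+ j * s ^+ (m.+1 - j) * phi j =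
  t * (\sum_(j < m.+1) 'C(m, j)%:R * t ^+ j * s ^+ (m - j) * phi j.+1) +
  s * (\sum_(j < m.+1) 'C(m, j)%:R * t ^+ j * s ^+ (m - j) * phi j).
Proof.
(* The second sum is shifted by one index; its extra top term carries a vanishing binomial
   coefficient, so both sums run over the same range. *)
rewrite big_ord_recl [X in s * X](_ : _ = s ^+ m * phi 0%N +
    \sum_(j < m.+1) 'C(m, j.+1)%:R * t ^+ j.+1 * s ^+ (m - j.+1) * phi j.+1).
  rewrite bin0 expr0 !subn0 !mul1r mulrDr addrCA !mulr_sumr mulrA -exprS.
  congr (_ + _); rewrite -big_split; apply: eq_bigr => j _ /=.
  rewrite /bump /= add1n binS natrD subSS.
  have [jm|mj] := ltnP j m; last by rewrite (@bin_small m j.+1) // exprS; ring.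
  by rewrite -(subnSK jm) !exprS; ring.
rewrite [in LHS]big_ord_recl [in RHS]big_ord_recr bin0 subn0 expr0 /= !mul1r.
by rewrite bin_small // !mul0r addr0.
Qed.

Lemma binomial_weight_sum (R : comNzRingType) (t : R) m :
  \sum_(j < m.+1) 'C(m, j)%:R * t ^+ j * (1 - t) ^+ (m - j) = 1.
Proof.
rewrite -[RHS](expr1n _ m) -[X in _ = X ^+ m](subrK t 1) exprDn.
by apply: eq_bigr => j _; rewrite -mulrA mulr_natl mulrC.
Qed.

(** Each further trial adds its own variance t (1 - t): the cross terms of the two branches of the
    recursion cancel. *)
Lemma binomial_variance (R : comNzRingType) (t : R) m :
  \sum_(j < m.+1) 'C(m, j)%:R * t ^+ j * (1 - t) ^+ (m - j)
    * (j%:R - m%:R * t) ^+ 2 = m%:R * t * (1 - t).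
Proof.
elim: m => [|m IH]; first by rewrite big_ord1 /=; ring.
rewrite (binomial_mean_recr _ _ (fun j => (j%:R - m.+1%:R * t) ^+ 2)).
have -> : m.+1%:R * t * (1 - t) = m%:R * t * (1 - t) + 1 * (t * (1 - t)).
  by rewrite -natr1; ring.
rewrite -IH -[X in _ = _ + X * _](binomial_weight_sum t m) mulr_suml.
rewrite !mulr_sumr -!big_split /=.
by apply: eq_bigr => j _; rewrite -[j.+1%:R]natr1 -[m.+1%:R]natr1; ring.
Qed.

(** The mean deviation is at most the standard deviation, and t (1 - t) <= 1/4. A pointwise bound,
    averaged afterwards, stands in for Cauchy-Schwarz. *)
Lemma binomial_mean_dist (R : realType) (t : R) m : 0 <= t <= 1 -> (0 < m)%N ->
  \sum_(j < m.+1) 'C(m, j)%:R * t ^+ j * (1 - t) ^+ (m - j)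
    * `|j%:R / m%:R - t| <= (2 * Num.sqrt m%:R)^-1.
Proof.
move=> /andP[t0 t1] m0; set q := Num.sqrt _.
have m0' : 0 < m%:R :> R by rewrite ltr0n.
have q0 : 0 < q by rewrite sqrtr_gt0.
have qq : q ^+ 2 = m%:R by rewrite sqr_sqrtr // ltW.
(* AM-GM: |d| <= q d^2 + 1 / (4 q) *)
have amgm (j : nat) : `|j%:R / m%:R - t| <=
    (j%:R - m%:R * t) ^+ 2 * (q ^+ 3)^-1 + (4 * q)^-1.
  have -> : j%:R / m%:R - t = (j%:R - m%:R * t) / q ^+ 2.
    by rewrite qq; field; rewrite gt_eqF.
  set d := _ - _ * t; rewrite normrM [ `|_^-1| ]gtr0_norm ?invr_gt0 ?exprn_gt0 //.
  rewrite -(real_normK (num_real d)); set e := `|d|.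
  rewrite -subr_ge0 [leRHS](_ : _ = (e / q - 2^-1) ^+ 2 / q).
    by rewrite divr_ge0 ?sqr_ge0 ?ltW.
  by field; rewrite gt_eqF.
apply: (@le_trans _ _ (\sum_(j < m.+1) 'C(m, j)%:R * t ^+ j * (1 - t) ^+ (m - j) *
    ((j%:R - m%:R * t) ^+ 2 * (q ^+ 3)^-1 + (4 * q)^-1))).
  apply: ler_sum => j _; apply: ler_wpM2l => //.
  by rewrite !mulr_ge0 // exprn_ge0 // subr_ge0.
under eq_bigr do rewrite mulrDr mulrA.
rewrite big_split -!mulr_suml /= binomial_weight_sum binomial_variance -qq mul1r.
(* The gap is a square because 1/4 - t (1 - t) = (1/2 - t)^2. *)
rewrite -subr_ge0 [leRHS](_ : _ = (2^-1 - t) ^+ 2 / q) ?divr_ge0 ?sqr_ge0 ?ltW //.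
by field; rewrite gt_eqF.
Qed.

(** The weights sum to 1, so [g x] can be moved under the sum; [t] is the affine coordinate of [x]
    on [al, ar]. *)
Lemma hornerB_bernstein (R : realType) (al ar : R) (g : R -> R[i]) (m : nat)
    (x : R) : al < ar ->
  let t := (x - al) / (ar - al) in
  (bernstein al ar g m).[x%:C] - g x =
  \sum_(j < m.+1) ('C(m, j)%:R * t ^+ j * (1 - t) ^+ (m - j))%:C *
     (g (al + j%:R / m%:R * (ar - al)) - g x).
Proof.
move=> alr t; have d0 : ar - al != 0 by rewrite subr_eq0 gt_eqF.
under [RHS]eq_bigr do rewrite mulrBr.
rewrite sumrB -mulr_suml -rmorph_sum /= binomial_weight_sum rmorph1 mul1r.
congr (_ - _); rewrite /bernstein hornerZ horner_sum mulr_sumr.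
apply: eq_bigr => j _.
rewrite hornerZ hornerM !horner_exp !hornerD !hornerN !hornerC hornerX.
have -> : 1 - t = (ar - x) / (ar - al) by rewrite /t; field.
have /subnKC jm : (j <= m)%N by rewrite -ltnS.
rewrite -[X in _ ^- X]jm exprD !rmorphM !rmorphXn /= !rmorphM /= !exprMn.
rewrite rmorph_nat fmorphV /= !rmorphB /= !exprVn invfM.
by ring.
Qed.

Lemma bernstein_approx (R : realType) (al ar L : R) (g : R -> R[i]) (m : nat)
    (x : R) : al < ar -> (0 < m)%N ->
  (forall y z, al <= y <= ar -> al <= z <= ar ->
     normc (g y - g z) <= L * `|y - z|) ->
  al <= x <= ar ->
  normc ((bernstein al ar g m).[x%:C] - g x) <=
    (ar - al) * L / (2 * Num.sqrt m%:R).
Proof.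
move=> alr m0 gL xI; rewrite hornerB_bernstein //; set t := _ / _.
have d0 : 0 < ar - al by rewrite subr_gt0.
have t01 : 0 <= t <= 1.
  by rewrite /t divr_ge0 ?ler_pdivrMr //= ?mul1r; lra.
(* The sign of [L] is read off the Lipschitz estimate between the endpoints. *)
have L0 : 0 <= L * (ar - al).
  rewrite -(gtr0_norm d0); apply: le_trans (gL ar al _ _); rewrite ?normc_ge0 //;
  lra.
apply: le_trans (normc_sum _) _.
rewrite [_ * L]mulrC; apply: le_trans (ler_wpM2l L0 (binomial_mean_dist t01 m0)).
rewrite mulr_sumr; apply: ler_sum => j _.
have w0 : 0 <= 'C(m, j)%:R * t ^+ j * (1 - t) ^+ (m - j).
  by case/andP: t01 => ? ?; rewrite !mulr_ge0 // exprn_ge0 // subr_ge0.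
rewrite ComplexField.Normc.normcM normc_real ger0_norm // [leRHS]mulrCA.
apply: ler_wpM2l => //; apply: le_trans (gL _ _ _ xI) _.
  have : 0 <= j%:R / m%:R :> R by rewrite divr_ge0.
  have : j%:R / m%:R <= 1 :> R.
    by rewrite ler_pdivrMr ?ltr0n // mul1r ler_nat -ltnS.
  by move=> ? ?; apply/andP; split; nra.
have -> : al + j%:R / m%:R * (ar - al) - x = (j%:R / m%:R - t) * (ar - al).
  by rewrite /t; field; rewrite ?(gt_eqF d0) ?pnatr_eq0 -?lt0n.
by rewrite normrM (gtr0_norm d0) -mulrA [(ar - al) * _]mulrC.
Qed.

(** Since 2 ln m >= 1, the logarithmic factor only weakens the bound D / (2 sqrt m), and so does the
    nonnegative term 4 M. *)
Lemma bernstein_rate (R : realType) (M D : R) (m : nat) : 0 <= M -> 0 <= D ->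
  (3 <= m)%N ->
  D / (2 * Num.sqrt m%:R) <=
    Num.sqrt 2 * (4 * M + D / 2) * Num.sqrt (ln m%:R / m%:R).
Proof.
move=> M0 D0 m3.
have m0 : 0 < m%:R :> R by rewrite ltr0n (leq_trans _ m3).
have q0 : 0 < Num.sqrt m%:R :> R by rewrite sqrtr_gt0.
(* From exp(-1/2) >= 1 - 1/2 follows exp(1/2) <= 2 <= m. *)
have lnm : 2^-1 <= ln m%:R :> R.
  rewrite -ler_expR lnK ?posrE //; apply: (@le_trans _ _ 2); last first.
    by rewrite ler_nat ltnW.
  rewrite -lef_pV2 ?posrE ?expR_gt0 // -expRN; apply: le_trans (expR_ge1Dx _).
  by lra.
have s2l : 1 <= Num.sqrt 2 * Num.sqrt (ln m%:R) :> R.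
  by rewrite -sqrtrM // -[leLHS]sqrtr1 ler_sqrt; lra.
rewrite sqrtrM; last lra.
rewrite (sqrtrV (ltW m0)) invfM [leLHS]mulrA [leRHS]mulrA.
apply: ler_wpM2r; first by rewrite invr_ge0 ltW.
rewrite mulrAC; set X := _ * Num.sqrt _ in s2l *.
by nra.
Qed.

(** * Reachability and the characteristic polynomial *)

Lemma reachability_mx_unit (R : realType) (n : nat) (M : 'M[R[i]]_n)
    (v : 'cV[R[i]]_n) : reachable M v -> reachability_mx M v \in unitmx.
Proof.
move=> /freeP Mv; rewrite -unitmx_tr -row_free_unit; apply: inj_row_free => w w0.
apply/rowP => j; rewrite mxE; apply: (Mv (fun i => w 0 i)).
apply/colP => i; move/rowP: w0 => /(_ i); rewrite !mxE => <-.
rewrite summxE; apply: eq_bigr => k _.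
by rewrite (nth_map k) ?size_enum_ord // nth_ord_enum !mxE.
Qed.

Lemma horner_mx_comp_scalar (R : comNzRingType) (n : nat) (M : 'M[R]_n.+1)
    (p q : {poly R}) (c : R) :
  horner_mx M q = c%:M -> horner_mx M (p \Po q) = (p.[c])%:M.
Proof.
move=> qc; rewrite comp_polyE horner_coef !rmorph_sum /=.
apply: eq_bigr => k _.
by rewrite horner_mxZ rmorphXn /= qc -rmorphXn /= scale_scalar_mx.
Qed.

(** By Cayley-Hamilton q(M) is the scalar c, hence each p_k(q(M)) is the scalar p_k(c), and what
    remains is a combination of the columns M^k v. *)
Lemma horner_mx_reachability (R : realType) (n : nat) (M : 'M[R[i]]_n.+1)
    (v : 'cV[R[i]]_n.+1) (q : {poly R[i]}) (c : R[i])
    (p : 'I_n.+1 -> {poly R[i]}) :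
  char_poly M = q - c%:P ->
  horner_mx M (\sum_k (p k \Po q) * 'X^k) *m v =
  reachability_mx M v *m \col_k (p k).[c].
Proof.
move=> Mq.
have qc : horner_mx M q = c%:M.
  have /eqP := Cayley_Hamilton M.
  by rewrite Mq rmorphB /= horner_mx_C subr_eq0 => /eqP.
rewrite rmorph_sum mulmx_suml; apply/colP => i; rewrite summxE !mxE.
apply: eq_bigr => k _; rewrite rmorphM rmorphXn /= horner_mx_X.
rewrite (horner_mx_comp_scalar _ qc) -mulmxE mul_scalar_mx -scalemxAl.
by rewrite !mxE mulrC.
Qed.

(** The input of time k is propagated by A^(N - k), so the coefficients have to be fed in reverse
    order. *)
Lemma solution_horner_mx (R : realType) (n : nat) (A : R[i] -> 'M[R[i]]_n.+1)
    (b : R[i] -> 'cV[R[i]]_n.+1) (N : nat) (alpha : nat -> R[i])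
    (theta : R[i]) :
  solution A b N.+1 (fun t => alpha (N - t)%N) (fun=> 0) theta =
  horner_mx (A theta) (\sum_(l < N.+1) alpha l *: 'X^l) *m b theta.
Proof.
rewrite solutionE (reindex_inj rev_ord_inj) rmorph_sum mulmx_suml /=.
apply: eq_bigr => k _; rewrite horner_mxZ rmorphXn /= horner_mx_X -scalemxAl.
by rewrite subKn // -ltnS.
Qed.

(** A nonconstant polynomial has a root over an algebraically closed field. Under (S1) and (N2) this
    makes a_0 injective on P. *)
Lemma char_poly_eq_eigenvalue (F : closedFieldType) (n : nat)
    (M M' : 'M[F]_n.+1) : char_poly M = char_poly M' ->
  exists x, eigenvalue M x /\ eigenvalue M' x.
Proof.
move=> MM'; have /closed_rootP[x rx] : size (char_poly M) != 1%N.
  by rewrite size_char_poly.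
by exists x; rewrite !eigenvalue_root_char -MM'.
Qed.

Lemma char_poly_eq_spectrum_meet (R : realType) (n : nat)
    (M M' : 'M[R[i]]_n.+1) : char_poly M = char_poly M' ->
  spectrum M `&` spectrum M' !=set0.
Proof. by move/(@char_poly_eq_eigenvalue R[i]) => [x Mx]; exists x. Qed.

(** Compares constant coefficients. It makes a_0 a polynomial in the entries of A, through which a_0
    inherits their smoothness along P. *)
Lemma char_poly_constant_coef (R : comNzRingType) (n : nat) (M : 'M[R]_n)
    (a : nat -> R) (c : R) : (0 < n)%N ->
  char_poly M = 'X^n - (\sum_(1 <= i < n) a i *: 'X^i + c%:P) ->
  c = (-1) ^+ n.+1 * \det M.
Proof.
move=> n0 /(congr1 (fun p : {poly R} => p`_0)).
rewrite char_poly_det exprS mulN1r mulNr => ->; rewrite coefB coefXn (ltn_eqF n0) coefD coefC coef_sum.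
rewrite big_nat_cond big1 => [|k /andP[/andP[k0 _] _]].
  by rewrite eqxx sub0r add0r opprK.
by rewrite coefZ coefXn (ltn_eqF k0) mulr0.
Qed.

(** * Rings of functions and matrix operations *)

(* The instances are the functions continuous on P, those C^1 along P, and the
   bounded ones with increments dominated by those of a_0. *)
Record pointwise_subring (T : Type) (R : comNzRingType)
    (Q : (T -> R) -> Prop) : Prop := {
  pointwise_cst : forall c, Q (fun=> c);
  pointwise_add : forall F G, Q F -> Q G -> Q (fun x => F x + G x);
  pointwise_mul : forall F G, Q F -> Q G -> Q (fun x => F x * G x) }.

Section PointwiseSubring.
Variables (T : Type) (R : comNzRingType) (Q : (T -> R) -> Prop).
Hypothesis Qring : pointwise_subring Q.

Lemma pointwise_sum (I : Type) (r : seq I) (p : pred I) (F : I -> T -> R) :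
  (forall k, Q (F k)) -> Q (fun x => \sum_(k <- r | p k) F k x).
Proof.
move=> QF; elim: r => [|k r IH].
  by under eq_fun do rewrite big_nil; exact: pointwise_cst.
under eq_fun do rewrite big_cons.
by case: (p k) => //; exact: pointwise_add.
Qed.

Lemma pointwise_prod (I : Type) (r : seq I) (p : pred I) (F : I -> T -> R) :
  (forall k, Q (F k)) -> Q (fun x => \prod_(k <- r | p k) F k x).
Proof.
move=> QF; elim: r => [|k r IH].
  by under eq_fun do rewrite big_nil; exact: pointwise_cst.
under eq_fun do rewrite big_cons.
by case: (p k) => //; exact: pointwise_mul.
Qed.

Lemma pointwise_det (n : nat) (M : T -> 'M[R]_n) :
  (forall i j, Q (fun x => M x i j)) -> Q (fun x => \det (M x)).
Proof.
move=> QM; apply: pointwise_sum => s; apply: pointwise_mul => //.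
  exact: pointwise_cst.
by apply: pointwise_prod.
Qed.

Lemma pointwise_mulmx (m n p : nat) (M : T -> 'M[R]_(m, n))
    (M' : T -> 'M[R]_(n, p)) :
  (forall i j, Q (fun x => M x i j)) -> (forall i j, Q (fun x => M' x i j)) ->
  forall i j, Q (fun x => (M x *m M' x) i j).
Proof.
move=> QM QM' i j; under eq_fun do rewrite mxE.
by apply: pointwise_sum => k; exact: pointwise_mul.
Qed.

Lemma pointwise_adj (n : nat) (M : T -> 'M[R]_n) :
  (forall i j, Q (fun x => M x i j)) ->
  forall i j, Q (fun x => (\adj (M x)) i j).
Proof.
move=> QM i j; under eq_fun do rewrite mxE.
apply: pointwise_mul => //; first exact: pointwise_cst.
by apply: pointwise_det => k l; under eq_fun do rewrite !mxE.
Qed.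

End PointwiseSubring.

Lemma pointwise_reachability_mx (T : Type) (R : realType) (n : nat)
    (Q : (T -> R[i]) -> Prop) (A : T -> 'M[R[i]]_n) (b : T -> 'cV[R[i]]_n) :
  pointwise_subring Q ->
  (forall i j, Q (fun x => A x i j)) -> (forall i, Q (fun x => b x i ord0)) ->
  forall i j, Q (fun x => reachability_mx (A x) (b x) i j).
Proof.
move=> Qring QA Qb i j; under eq_fun do rewrite mxE.
elim: (j : nat) i => {j} [|j IH] i.
  by under eq_fun do rewrite expr0 mul1mx.
under eq_fun do rewrite exprS -mulmxE -mulmxA.
apply: (@pointwise_mulmx _ _ _ Qring _ _ _ A (fun x => A x ^+ j *m b x)) => //.
by move=> k l; rewrite ord1; exact: IH.
Qed.

(** * Continuous and differentiable functions on an arc *)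

Lemma normc_cvg (R : realType) (T : Type) (F : set_system T) (FF : Filter F)
    (phi : T -> R[i]) (l : R[i]) :
  phi x @[x --> F] --> l -> normc (phi x) @[x --> F] --> normc l.
Proof.
move=> /cvgrPdist_lt phil; apply/cvgrPdist_lt => e e0.
have e0' : 0 < e%:C by rewrite ltcR.
apply: filterS (phil _ e0') => x; rewrite normcE ltcR; apply: le_lt_trans.
rewrite ler_norml; apply/andP; split.
  rewrite lerNl opprB lerBlDr addrC -normc_subC.
  by have := normc_le_add (phi x - l) l; rewrite subrK addrC normc_subC.
by rewrite lerBlDr; have := normc_le_add (l - phi x) (phi x); rewrite subrK.
Qed.

Lemma within_continuous_bounded (R : realType) (P : set R[i])
    (phi : R[i] -> R[i]) :
  compact P -> {within P, continuous phi} ->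
  exists K, forall z, P z -> normc (phi z) <= K.
Proof.
move=> cP cphi; pose psi z := normc (phi z).
have cpsi : {within P, continuous psi}.
  apply/subspace_continuousP => z Pz; apply: normc_cvg.
  by move/subspace_continuousP : cphi; apply.
have [K [Kr KP]] := compact_bounded (continuous_compact cpsi cP).
exists (K + 1) => z Pz.
have := KP (K + 1); rewrite ltrDl ltr01 => /(_ isT (psi z)).
rewrite /= ger0_norm ?normc_ge0 //; apply; by exists z.
Qed.

Lemma jordan_arc_compact (R : realType) (P : set R[i]) :
  jordan_arc P -> compact P.
Proof.
move=> [c [d [h [h' [_ <- _ hc _]]]]].
by apply: continuous_compact => //; exact: segment_compact.
Qed.

Lemma within_continuous_entry (R : realType) (m n : nat) (P : set R[i])
    (M : R[i] -> 'M[R[i]]_(m, n)) i j :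
  {within P, continuous M} -> {within P, continuous (fun z => M z i j)}.
Proof.
move=> /subspace_continuousP cM; apply/subspace_continuousP => z Pz.
exact: (cvg_comp _ _ (cM z Pz) (@coord_continuous _ _ _ i j (M z))).
Qed.

Lemma within_continuous_subring (R : realType) (P : set R[i]) :
  pointwise_subring (fun phi : R[i] -> R[i] => {within P, continuous phi}).
Proof.
split=> [c|F G|F G].
- by apply/subspace_continuousP => z _; exact: cvg_cst.
- move=> /subspace_continuousP cF /subspace_continuousP cG.
  by apply/subspace_continuousP => z Pz; apply: cvgD; [exact: cF|exact: cG].
- move=> /subspace_continuousP cF /subspace_continuousP cG.
  by apply/subspace_continuousP => z Pz; apply: cvgM; [exact: cF|exact: cG].
Qed.

(** Continuity is carried along with differentiability because the product rule takes the limit of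
    one factor at z. *)
Lemma C1_on_subring (R : realType) (P : set R[i]) :
  pointwise_subring (fun phi : R[i] -> R[i] =>
    {within P, continuous phi} /\ C1_on P phi).
Proof.
have Qc := within_continuous_subring P.
split=> [c|F G [cF [F' cF' dF]] [cG [G' cG' dG]]|
  F G [cF [F' cF' dF]] [cG [G' cG' dG]]].
- split; first exact: (pointwise_cst Qc).
  exists (fun=> 0); first exact: (pointwise_cst Qc).
  move=> z Pz; rewrite /has_derivative_on.
  by under eq_fun do rewrite subrr scaler0; exact: cvg_cst.
- split; first exact: (pointwise_add Qc cF cG).
  exists (fun z => F' z + G' z); first exact: (pointwise_add Qc cF' cG').
  move=> z Pz; rewrite /has_derivative_on.
  under eq_fun do rewrite opprD addrACA scalerDr.
  by apply: cvgD; [exact: dF|exact: dG].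
- split; first exact: (pointwise_mul Qc cF cG).
  exists (fun z => F' z * G z + F z * G' z).
    exact: (pointwise_add Qc (pointwise_mul Qc cF' cG) (pointwise_mul Qc cF cG')).
  move=> z Pz; rewrite /has_derivative_on.
  (* Continuity on P is restricted to the punctured neighbourhoods on which difference quotients are
     taken. *)
  have cGz : G w @[w --> within (P `\ z) (nbhs z)] --> G z.
    move/subspace_continuousP : cG => /(_ z Pz) h U /h; rewrite /within /=.
    by apply: (@filterS _ (nbhs z)) => w /= PU [/PU].
  rewrite (_ : (fun w => _) = (fun w => (w - z)^-1 *: (F w - F z) * G w +
      F z * ((w - z)^-1 *: (G w - G z)))); last first.
    by apply/funext => w; rewrite /GRing.scale /=; ring.
  have cFz : F z @[w --> within (P `\ z) (nbhs z)] --> F z by exact: cvg_cst.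
  have dFG := cvgM (dF z Pz) cGz; have dGF := cvgM cFz (dG z Pz).
  have dFGF := cvgD (dFG _) (dGF _).
  exact: dFGF.
Qed.

(** * Norms of vectors and matrices *)

Lemma is_norm0 (R : realType) (V : lmodType R[i]) (N : V -> R) :
  is_norm N -> N 0 = 0.
Proof.
by case=> _ NZ _; rewrite -(scale0r 0) NZ ComplexField.Normc.normc0 mul0r.
Qed.

Lemma is_norm_ge0 (R : realType) (V : lmodType R[i]) (N : V -> R) (v : V) :
  is_norm N -> 0 <= N v.
Proof.
move=> NN; have [ND NZ _] := NN; have := ND v (- v).
rewrite subrr is_norm0 // -scaleN1r NZ normc_opp ComplexField.Normc.normc1.
by rewrite mul1r; lra.
Qed.

Lemma is_norm_sum (R : realType) (V : lmodType R[i]) (N : V -> R)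
    (I : Type) (s : seq I) (p : pred I) (F : I -> V) :
  is_norm N -> N (\sum_(k <- s | p k) F k) <= \sum_(k <- s | p k) N (F k).
Proof.
move=> NN; elim/big_ind2: _ => [|x1 x2 y1 y2 h1 h2|//].
  by rewrite is_norm0.
by case: NN => ND _ _; rewrite (le_trans (ND _ _)) ?lerD.
Qed.

(** Expansion in the matrix units; it turns bounds on the entries of S into a bound on its norm over
    P. *)
Lemma is_norm_mx_le (R : realType) (m n : nat) (N : 'M[R[i]]_(m, n) -> R)
    (X : 'M[R[i]]_(m, n)) (K : 'I_m -> 'I_n -> R) : is_norm N ->
  (forall i j, normc (X i j) <= K i j) ->
  N X <= \sum_i \sum_j K i j * N (delta_mx i j).
Proof.
move=> NN XK; rewrite [X in N X]matrix_sum_delta.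
apply: le_trans (is_norm_sum _ _ _ NN) _; apply: ler_sum => i _.
apply: le_trans (is_norm_sum _ _ _ NN) _; apply: ler_sum => j _.
have [_ -> _] := NN.
by apply: ler_wpM2r => //; exact: is_norm_ge0.
Qed.

(* delta_mx k k maps v to v_k e_k, so a submultiplicative matrix norm controls
   each coordinate and no equivalence of norms is needed. *)
Lemma coord_le_norm (R : realType) (n : nat) (N : 'cV[R[i]]_n -> R)
    (NM : 'M[R[i]]_n -> R) (k : 'I_n) : is_norm N ->
  (forall X v, N (X *m v) <= NM X * N v) ->
  exists C, forall v : 'cV[R[i]]_n, normc (v k ord0) <= C * N v.
Proof.
move=> NN NMsub; have [_ NZ N0] := NN.
have e0 : 0 < N (delta_mx k ord0).
  rewrite lt0r is_norm_ge0 // andbT; apply/eqP => /N0 /matrixP /(_ k ord0).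
  by rewrite !mxE !eqxx => /eqP; rewrite oner_eq0.
exists (NM (delta_mx k k) / N (delta_mx k ord0)) => v.
rewrite mulrAC ler_pdivlMr // -NZ; apply: le_trans (NMsub _ _).
rewrite le_eqVlt; apply/orP; left; apply/eqP; congr N.
apply/colP => i; rewrite !mxE (bigD1 k) //= big1 => [|j jk].
  by rewrite !mxE eqxx eqxx !andbT addr0 mulrC.
by rewrite mxE (negbTE jk) andbF mul0r.
Qed.

(** * Domination of increments along an arc *)

(* F and r need not be continuous: the supremum m of the points up to which the
   estimate holds is reached, and passed, through the local estimate at m. *)
Lemma local_dominated_increments (R : realType) (c d K : R) (F : R -> R[i])
    (r : R -> R) : 0 <= K ->
  (forall s t, c <= s -> s <= t -> t <= d -> r s <= r t) ->
  (forall t, c <= t <= d -> exists2 e, 0 < e & forall s, c <= s <= d ->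
     `|s - t| < e -> normc (F s - F t) <= K * `|r s - r t|) ->
  forall s t, c <= s -> s <= t -> t <= d ->
    normc (F t - F s) <= K * (r t - r s).
Proof.
move=> K0 rmono loc s t cs st td.
pose E := [set u | s <= u <= t /\ normc (F u - F s) <= K * (r u - r s)].
have Es : E s by rewrite /E /= lexx st !subrr ComplexField.Normc.normc0 mulr0.
have Eub : ubound E t by move=> u [/andP[]].
have Esup : has_sup E by split; [exists s|exists t].
set m := sup E.
have sm : s <= m by apply: ub_le_sup => //; exists t.
have mt : m <= t by apply: ge_sup => //; exists s.
have [|e e0 locm] := loc m; first by rewrite (le_trans cs sm) (le_trans mt td).
(* Estimates chain from [u] to [v] because [r] is monotone: its increments add up without absolute
   values. *)
have step u v : E u -> s <= v <= t -> u <= v ->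
    normc (F v - F u) <= K * `|r v - r u| -> E v.
  move=> [/andP[su ut] Fu] /andP[sv vt] uv Fvu; split; first by rewrite sv vt.
  have ruv : r u <= r v by rewrite rmono // ?(le_trans cs) // (le_trans vt).
  move: Fvu; rewrite ger0_norm ?subr_ge0 // => Fvu.
  rewrite -[F v](subrK (F u)) -addrA; apply: le_trans (normc_le_add _ _) _.
  by apply: le_trans (lerD Fvu Fu) _; rewrite -mulrDr addrA subrK.
(* Some [u] of [E] lies within [e] of the supremum, so the local estimate at [m] carries [u] to
   [m]. *)
have Em : E m.
  have [u Eu mu] := sup_adherent e0 Esup.
  have um : u <= m by apply: ub_le_sup => //; exists t.
  have [/andP[su ut] _] := Eu.
  apply: (step u) => //; first by rewrite sm mt.
  rewrite normc_subC distrC; apply: locm.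
    by rewrite (le_trans cs su) (le_trans ut td).
  by rewrite ler0_norm ?subr_le0 // opprB ltrBlDr -ltrBlDl.
have [->|mt'] := eqVneq t m; first by case: Em.
have mltt : m < t by rewrite lt_neqAle eq_sym mt' mt.
(* Half the radius keeps [v] strictly within [e] of [m]; a point of [E] beyond [m] contradicts the
   supremum. *)
pose v := Num.min t (m + e / 2).
have mv : m < v by rewrite lt_min mltt ltrDl divr_gt0.
have vt : v <= t by rewrite ge_min lexx.
have ve : v <= m + e / 2 by rewrite ge_min lexx orbT.
suff /ub_le_sup : E v by move=> /(_ (ex_intro _ t Eub)); rewrite leNgt mv.
apply: (step m) => //; first by rewrite vt (le_trans sm) // ltW.
  exact: ltW.
apply: locm; first by rewrite (le_trans vt td) (le_trans (le_trans cs sm)) // ltW.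
by rewrite gtr0_norm ?subr_gt0 //; lra.
Qed.

(** Near z the quotient of [phi] stays below a bound of |phi'| plus one, and that of [rho] above
    half a lower bound of |rho'|. Compactness makes the constant uniform in z; the neighbourhood
    still depends on z. *)
Lemma dominated_quotients (R : realType) (P : set R[i]) (phi rho : R[i] -> R[i]) :
  compact P -> C1_on P phi ->
  (exists2 rho', {within P, continuous rho'} & forall z, P z ->
     has_derivative_on P rho z (rho' z) /\ rho' z != 0) ->
  exists2 K, 0 <= K & forall z, P z -> \forall w \near nbhs z, P w ->
    normc (phi w - phi z) <= K * normc (rho w - rho z).
Proof.
move=> cP [phi' cphi' dphi] [rho' crho' drho].
have [K1 K1P] := within_continuous_bounded cP cphi'.
have [|K2 K2P] := @within_continuous_bounded _ _ (fun z => (rho' z)^-1) cP.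
  apply/subspace_continuousP => z Pz; apply: cvgV; first by case: (drho z Pz).
  by move/subspace_continuousP : crho'; apply.
(* The maxima make [M1] nonnegative and [M2] positive, so that [M2] can be inverted. *)
pose M1 := Num.max K1 0; pose M2 := Num.max K2 1.
have M2gt0 : 0 < M2 by rewrite lt_max ltr01 orbT.
have M1ge0 : 0 <= M1 by rewrite le_max lexx orbT.
exists ((M1 + 1) * (2 * M2)).
  by rewrite !mulr_ge0 ?addr_ge0 // ltW.
move=> z Pz; have [drz rz0] := drho z Pz.
have e10 : 0 < 1%:C :> R[i] by rewrite ltcR.
have e20 : 0 < ((2 * M2)^-1)%:C :> R[i] by rewrite ltcR invr_gt0 mulr_gt0.
move/cvgrPdist_lt : (dphi z Pz) => /(_ _ e10).
move/cvgrPdist_lt : drz => /(_ _ e20).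
rewrite /within /=; apply: (@filterS2 _ (nbhs z)) => w rw fw Pw.
(* The difference quotients are controlled only at points other than z. *)
have [->|wz] := eqVneq w z.
  by rewrite !subrr ComplexField.Normc.normc0 mulr0.
have Pwz : (P `\ z) w by split => //; exact/eqP.
have wz0 : w - z != 0 by rewrite subr_eq0.
have nwz : 0 < normc (w - z) by rewrite normc_gt0.
have := fw Pwz; have := rw Pwz; rewrite !normcE !ltcR {fw rw}.
rewrite /GRing.scale /=.
set q := _^-1 * (rho w - _); set p := _^-1 * (phi w - _) => qr pf.
have -> : phi w - phi z = (w - z) * p by rewrite mulrA divff ?mul1r.
have -> : rho w - rho z = (w - z) * q by rewrite mulrA divff ?mul1r.
rewrite (ComplexField.Normc.normcM _ p) (ComplexField.Normc.normcM _ q).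
rewrite [leRHS]mulrCA; apply: ler_wpM2l; first exact: ltW.
have p1 : normc p <= M1 + 1.
  rewrite -[p](subrK (phi' z)); apply: le_trans (normc_le_add _ _) _.
  rewrite addrC lerD //; first by rewrite le_max K1P.
  by rewrite normc_subC ltW.
have q1 : 1 <= 2 * M2 * normc q.
  have : M2^-1 <= normc (rho' z).
    rewrite -[leRHS]invrK -ComplexField.Normc.normcV lef_pV2 ?posrE //.
      by rewrite le_max K2P.
    by rewrite normc_gt0 invr_eq0.
  have := normc_le_add (rho' z - q) q; rewrite subrK => h1 h2.
  have : (2 * M2)^-1 <= normc q.
    have -> : (2 * M2)^-1 = M2^-1 - (2 * M2)^-1 by field; rewrite gt_eqF.
    by lra.
  by rewrite -ler_pdivrMl ?mulr1 // mulr_gt0.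
rewrite -mulrA -[leLHS]mulr1; apply: ler_pM => //; exact: normc_ge0.
Qed.

Lemma Re_cvg (R : realType) (T : Type) (F : set_system T) (FF : Filter F)
    (phi : T -> R[i]) (l : R[i]) :
  phi x @[x --> F] --> l -> complex.Re (phi x) @[x --> F] --> complex.Re l.
Proof.
move=> /cvgrPdist_lt phil; apply/cvgrPdist_lt => e e0.
have e0' : 0 < e%:C by rewrite ltcR.
apply: filterS (phil _ e0') => x; rewrite normcE ltcR; apply: le_lt_trans.
rewrite -lecR -normcE; apply: le_trans (normc_ge_Re _).
by rewrite lecR raddfB.
Qed.

(** The arc is merely a continuous curve, so increments of [phi] are compared with those of [rho]
    and never with the parameter; the parametrization serves to order the points. *)
Lemma arc_dominated_increments (R : realType) (P : set R[i])
    (phi rho : R[i] -> R[i]) (r : R[i] -> R) (K : R) :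
  jordan_arc P -> {within P, continuous rho} ->
  (forall z w, P z -> P w -> rho z = rho w -> z = w) ->
  (forall z, P z -> rho z = (r z)%:C) -> 0 <= K ->
  (forall z, P z -> \forall w \near nbhs z, P w ->
     normc (phi w - phi z) <= K * normc (rho w - rho z)) ->
  forall z w, P z -> P w ->
    normc (phi w - phi z) <= K * normc (rho w - rho z).
Proof.
move=> [c [d [h [h' [cd hP hK ch _]]]]] crho rho_inj rhor K0 loc.
have Ph t : c <= t <= d -> P (h t).
  by move=> tI; rewrite -hP; exists t => //=; rewrite in_itv.
have rh t : c <= t <= d -> rho (h t) = (r (h t))%:C.
  by move=> tI; rewrite rhor //; exact: Ph.
(* Neighbourhoods along P pull back through [h] to neighbourhoods within [c, d]. *)
have cvgh t : c <= t <= d -> forall U, within P (nbhs (h t)) U ->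
    \forall s \near nbhs t, c <= s <= d -> U (h s).
  move=> tI U; move/subspace_continuousP : ch => /(_ t).
  rewrite /= in_itv /= => /(_ tI) cht PU; have := cht _ PU.
  rewrite /= /within /=; apply: (@filterS _ (nbhs t)) => s /= sU sI.
  by apply: sU; [rewrite in_itv|exact: Ph].
(* Taking the real part lets [f] inherit continuity from [rho]; about [r] only its values on P are
   known. *)
pose f t := complex.Re (rho (h t)).
have fr t : c <= t <= d -> f t = r (h t) by move=> tI; rewrite /f rh.
have cf : {within `[c, d], continuous f}.
  apply/subspace_continuousP => t; rewrite /= in_itv /= => tI; apply: Re_cvg.
  move/subspace_continuousP : crho => /(_ _ (Ph t tI)) crho U /crho PU.
  have := cvgh _ tI _ PU; rewrite /= /within /=.
  by apply: (@filterS _ (nbhs t)) => s /= sU; rewrite in_itv; exact: sU.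
have finj : {in `[c, d] &, injective f}.
  move=> s t sI tI; have := sI; have := tI; rewrite !in_itv /= => tI' sI'.
  rewrite !fr // => rst; rewrite -(hK s sI) -(hK t tI); congr h'.
  by apply: rho_inj; rewrite ?rh ?rst //; exact: Ph.
(* The sign [sg] treats an increasing and a decreasing pullback at once. *)
have glob (sg : R) (sg1 : `|sg| = 1) :
    {in `[c, d] &, {homo f : x y / x <= y >-> sg * x <= sg * y}} ->
    forall s t, c <= s -> s <= t -> t <= d ->
    normc (phi (h t) - phi (h s)) <= K * normc (rho (h t) - rho (h s)).
  move=> fmono s t cs st td.
  have sI : c <= s <= d by rewrite cs (le_trans st).
  have tI : c <= t <= d by rewrite td (le_trans cs).
  have fle : sg * f s <= sg * f t by apply: fmono; rewrite ?in_itv.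
  rewrite !rh // -rmorphB normc_real -!fr // -[`|_|]mul1r -sg1 -normrM.
  rewrite ger0_norm mulrBr ?subr_ge0 //.
  apply: (@local_dominated_increments _ c d K (phi \o h)
    (fun t => sg * f t)) => //.
    move=> u v cu uv vd; apply: fmono => //; rewrite in_itv /=.
      by rewrite cu (le_trans uv).
    by rewrite vd (le_trans cu).
  move=> u uI; have /nbhs_ballP[e e0 he] := cvgh u uI _ (loc _ (Ph u uI)).
  exists e => // v vI; rewrite distrC => /he /(_ vI) /=.
  by rewrite -mulrBr normrM sg1 mul1r !rh // -rmorphB normc_real -!fr.
have globh s t : c <= s -> s <= t -> t <= d ->
    normc (phi (h t) - phi (h s)) <= K * normc (rho (h t) - rho (h s)).
  have [finc|fdec] := itv_continuous_inj_mono cf finj.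
    apply: (glob 1); first exact: normr1.
    move=> x y xI yI; rewrite !mul1r le_eqVlt => /predU1P[->//|xy].
    by rewrite ltW // finc.
  apply: (glob (-1)); first by rewrite normrN normr1.
  move=> x y xI yI; rewrite !mulN1r lerN2 le_eqVlt => /predU1P[->//|xy].
  by rewrite ltW // fdec.
move=> z w; rewrite -hP => -[s + <-] [t + <-].
rewrite /= !in_itv /= => /andP[cs sd] /andP[ct td].
have [st|ts] := leP s t; first exact: globh.
by rewrite normc_subC [X in _ * X]normc_subC; apply: globh => //; exact: ltW.
Qed.

(** Boundedness belongs to the predicate because the increment of a product multiplies an increment
    of one factor by a value of the other. *)
Lemma dominated_subring (R : realType) (T : Type) (P : set T) (D : T -> T -> R) :
  pointwise_subring (fun phi : T -> R[i] =>
    (exists K, forall z, P z -> normc (phi z) <= K) /\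
    (exists K, forall z w, P z -> P w -> normc (phi w - phi z) <= K * D z w)).
Proof.
split=> [c|F G [[KF FK] [LF FL]] [[KG GK] [LG GL]]|
    F G [[KF FK] [LF FL]] [[KG GK] [LG GL]]]; split.
- by exists (normc c).
- by exists 0 => z w _ _; rewrite subrr ComplexField.Normc.normc0 mul0r.
- exists (KF + KG) => z Pz; apply: le_trans (normc_le_add _ _) _.
  by rewrite lerD ?FK ?GK.
- exists (LF + LG) => z w Pz Pw; rewrite opprD addrACA mulrDl.
  by apply: le_trans (normc_le_add _ _) _; rewrite lerD ?FL ?GL.
- exists (KF * KG) => z Pz; rewrite ComplexField.Normc.normcM.
  by rewrite ler_pM ?normc_ge0 ?FK ?GK.
- exists (KF * LG + KG * LF) => z w Pz Pw.
  have -> : F w * G w - F z * G z = F w * (G w - G z) + G z * (F w - F z).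
    by ring.
  apply: le_trans (normc_le_add _ _) _.
  rewrite !ComplexField.Normc.normcM mulrDl -!mulrA.
  by rewrite lerD // ler_pM ?normc_ge0 ?FK ?GK ?FL ?GL.
Qed.

(** The increment of 1/phi is that of phi divided by -phi(w) phi(z), so a bound on 1/|phi|
    suffices. *)
Lemma dominated_inv (R : realType) (T : Type) (P : set T) (D : T -> T -> R)
    (phi : T -> R[i]) : (forall z, P z -> phi z != 0) ->
  (exists K, forall z, P z -> normc (phi z)^-1 <= K) ->
  (exists K, forall z w, P z -> P w -> normc (phi w - phi z) <= K * D z w) ->
  exists K, forall z w, P z -> P w ->
    normc ((phi w)^-1 - (phi z)^-1) <= K * D z w.
Proof.
move=> phi0 [K phiK] [L phiL]; exists (K * K * L) => z w Pz Pw.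
have -> : (phi w)^-1 - (phi z)^-1 =
    - ((phi w)^-1 * (phi z)^-1 * (phi w - phi z)).
  by field; rewrite !phi0.
rewrite normc_opp !(ComplexField.Normc.normcM _ _) -mulrA.
rewrite -[K * K * L * _]mulrA -mulrA.
by rewrite !ler_pM ?mulr_ge0 ?normc_ge0 ?phiK ?phiL.
Qed.

Lemma C1_on_entry (R : realType) (m n : nat) (P : set R[i])
    (M : R[i] -> 'M[R[i]]_(m, n)) i j :
  C1_on P M -> C1_on P (fun z => M z i j).
Proof.
move=> [M' cM' dM]; exists (fun z => M' z i j).
  exact: within_continuous_entry.
move=> z Pz.
have dMij := cvg_comp _ _ (dM z Pz) (@coord_continuous _ _ _ i j (M' z)).
rewrite /has_derivative_on; apply: cvg_trans dMij.
by apply: near_eq_cvg; near=> w; rewrite /= !mxE.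
Unshelve. all: by end_near.
Qed.

(** Fed to the domination argument, the identity shows that the inverse of a_0 is Lipschitz, which
    transfers the Lipschitz property of f from P to a_0(P). *)
Lemma C1_on_id (R : realType) (P : set R[i]) : C1_on P (fun z : R[i] => z).
Proof.
exists (fun=> 1); first exact: pointwise_cst (within_continuous_subring P) _.
move=> z Pz; rewrite /has_derivative_on.
have c1 : (fun=> 1 : R[i]) w @[w --> within (P `\ z) (nbhs z)] --> (1 : R[i]).
  exact: cvg_cst.
apply: cvg_trans c1.
apply: near_eq_cvg; rewrite near_withinE; near=> w => -[_ /eqP wz].
by rewrite /GRing.scale /= mulVf // subr_eq0.
Unshelve. all: by end_near.
Qed.

Lemma within_continuous_inv (R : realType) (P : set R[i])
    (phi : R[i] -> R[i]) : {within P, continuous phi} ->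
  (forall z, P z -> phi z != 0) -> {within P, continuous (fun z => (phi z)^-1)}.
Proof.
move=> /subspace_continuousP cphi phi0.
apply/subspace_continuousP => z Pz; apply: cvgV; first exact: phi0.
exact: cphi.
Qed.

(** * Suprema and the coordinates of S^-1 f *)

Lemma sup_norm_ge0 (R : realType) (T V : Type) (N : V -> R) (X : set T)
    (F : T -> V) : (forall v, 0 <= N v) -> 0 <= sup_norm N X F.
Proof.
move=> N0; rewrite /sup_norm.
(* An empty or unbounded set of values has supremum 0 by convention. *)
have [[[y Xy] Xub]|/sup_out->//] := pselect (has_sup [set N (F x) | x in X]).
by case: Xy (Xy) => x _ <- Fx; apply: le_trans (N0 (F x)) _; exact: ub_le_sup.
Qed.

(** Cramer's rule writes S^-1 f as adj(S) f / det S, so ring closure reduces the claim to the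
    entries of S, to 1 / det S and to f. *)
Lemma reachable_coordinates_Lip (R : realType) (n : nat) (n_gt0 : (0 < n)%N)
    (N : 'cV[R[i]]_n -> R) (NM : 'M[R[i]]_n -> R) (P : set R[i])
    (A : R[i] -> 'M[R[i]]_n) (b f : R[i] -> 'cV[R[i]]_n)
    (a0 : R[i] -> R[i]) (r : R[i] -> R) :
  is_norm N -> (forall X v, N (X *m v) <= NM X * N v) -> jordan_arc P ->
  {within P, continuous A} -> {within P, continuous b} ->
  {within P, continuous f} ->
  (forall theta, P theta -> reachable (A theta) (b theta)) ->
  (forall theta, P theta -> a0 theta = (-1) ^+ n.+1 * \det (A theta)) ->
  (forall theta theta', P theta -> P theta' -> a0 theta = a0 theta' ->
     theta = theta') ->
  (forall theta, P theta -> a0 theta = (r theta)%:C) ->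
  C1_on P A -> C1_on P b -> Lip N P f ->
  (forall theta, P theta -> forall d, has_derivative_on P a0 theta d -> d <> 0) ->
  forall k, exists K, forall z w, P z -> P w ->
    normc ((invmx (reachability_mx (A w) (b w)) *m f w) k ord0 -
           (invmx (reachability_mx (A z) (b z)) *m f z) k ord0)
    <= K * normc (a0 w - a0 z).
Proof.
move=> NN NMsub P_arc cA cb cf Ab a0E a0inj a0r C1A C1b [L L0 fL] a0d k.
have cP := jordan_arc_compact P_arc.
(* As a signed determinant [rho] is C^1 along P by ring closure; it agrees with a_0 on P, so its
   derivative is one of a_0 and does not vanish. *)
pose rho z := (-1) ^+ n.+1 * \det (A z).
have [crho [rho' crho' drho]] : {within P, continuous rho} /\ C1_on P rho.
  have Q1 := C1_on_subring P.
  apply: (pointwise_mul Q1 (pointwise_cst Q1 _)); apply: (pointwise_det Q1).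
  by move=> i j; split; [exact: within_continuous_entry|exact: C1_on_entry].
have rhoE z : P z -> rho z = a0 z by move=> Pz; rewrite a0E.
clearbody rho.
have rho'0 z : P z -> rho' z != 0.
  move=> Pz; apply/eqP; apply: (a0d z Pz); rewrite /has_derivative_on -rhoE //.
  apply: cvg_trans (drho z Pz); apply: near_eq_cvg.
  by rewrite near_withinE; near=> w => -[Pw _]; rewrite rhoE.
pose D z w := normc (a0 w - a0 z).
have Qd := dominated_subring P D.
set Q := (fun phi : R[i] -> R[i] => _ /\ _) in Qd.
have C1Q phi : {within P, continuous phi} -> C1_on P phi -> Q phi.
  move=> cphi C1phi; split; first exact: within_continuous_bounded.
  have [|K K0 loc] := dominated_quotients cP C1phi (rho := rho).
    exists rho'; first exact: crho'.
    move=> z Pz; split.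
      exact: drho.
    exact: rho'0.
  have rho_inj u v : P u -> P v -> rho u = rho v -> u = v.
    by move=> Pu Pv; rewrite !rhoE //; exact: a0inj.
  have rho_real u : P u -> rho u = (r u)%:C by move=> Pu; rewrite rhoE // a0r.
  exists K => z w Pz Pw; rewrite /D -!rhoE //.
  exact: (arc_dominated_increments P_arc crho rho_inj rho_real K0 loc).
have Qentry m (M : R[i] -> 'M[R[i]]_(n, m)) i j :
    {within P, continuous M} -> C1_on P M -> Q (fun z => M z i j).
  move=> cM C1M; apply: C1Q; first exact: within_continuous_entry.
  exact: C1_on_entry.
have QS i j : Q (fun z => reachability_mx (A z) (b z) i j).
  by apply: (pointwise_reachability_mx Qd) => *; exact: Qentry.
have Qf i j : Q (fun z => f z i j).
  rewrite ord1; split.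
    have cfi := @within_continuous_entry _ _ _ _ _ i ord0 cf.
    exact: (within_continuous_bounded cP cfi).
  have [C CN] := coord_le_norm i NN NMsub.
  (* As f is only Lipschitz, it enters the ring through the identity: N(f(w) - f(z)) <= L |w - z| <=
     L K |a_0(w) - a_0(z)|. *)
  have cid : {within P, continuous (fun z : R[i] => z)}.
    by apply/subspace_continuousP => z _; exact: cvg_within.
  have [_ [K idK]] := C1Q _ cid (C1_on_id P).
  (* The i-th basis vector gives 1 <= C N(e_i), hence the sign of [C]. *)
  have C0 : 0 <= C.
    have := CN (delta_mx i ord0); rewrite mxE !eqxx ComplexField.Normc.normc1.
    have := is_norm_ge0 (delta_mx i ord0) NN; nra.
  exists (C * (L * K)) => z w Pz Pw.
  have := CN (f w - f z); rewrite !mxE => /le_trans; apply.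
  rewrite -!mulrA ler_wpM2l //; apply: le_trans (fL _ _ Pw Pz) _.
  by rewrite ler_wpM2l ?idK // ltW.
pose del z := \det (reachability_mx (A z) (b z)).
have S_unit z : P z -> reachability_mx (A z) (b z) \in unitmx.
  by move=> /Ab; exact: reachability_mx_unit.
have del0 z : P z -> del z != 0 by move=> /S_unit; rewrite unitmxE unitfE.
have Qdel : Q del by apply: (pointwise_det Qd).
have Qc := within_continuous_subring P.
have cdel : {within P, continuous del}.
  apply: (pointwise_det Qc); apply: (pointwise_reachability_mx Qc) => *;
  exact: within_continuous_entry.
(* On the compact arc a continuous, nowhere zero determinant has a bounded inverse. *)
have [Kd KdP] := within_continuous_bounded cP (within_continuous_inv cdel del0).
have Qidel : Q (fun z => (del z)^-1).
  split; first by exists Kd.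
  by case: Qdel => _; apply: dominated_inv => //; exists Kd.
have [_ [K KP]] := pointwise_mul Qd Qidel
  (pointwise_mulmx Qd (pointwise_adj Qd QS) Qf k ord0).
have coordE z : P z -> (invmx (reachability_mx (A z) (b z)) *m f z) k ord0 =
    (del z)^-1 * (\adj (reachability_mx (A z) (b z)) *m f z) k ord0.
  by move=> Pz; rewrite /invmx (S_unit z Pz) -scalemxAl mxE.
by exists K => z w Pz Pw; rewrite (coordE w Pw) (coordE z Pz); exact: KP.
Unshelve. all: by end_near.
Qed.

(** Ensures that the supremum norm of S is a true upper bound and not the default value of an
    unbounded set. *)
Lemma has_ubound_norm_reachability_mx (R : realType) (n : nat)
    (NM : 'M[R[i]]_n -> R) (P : set R[i]) (A : R[i] -> 'M[R[i]]_n)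
    (b : R[i] -> 'cV[R[i]]_n) : is_norm NM -> compact P ->
  {within P, continuous A} -> {within P, continuous b} ->
  has_ubound [set NM (reachability_mx (A z) (b z)) | z in P].
Proof.
move=> NN cP cA cb; have Qc := within_continuous_subring P.
have cS i j : {within P, continuous
    (fun z => reachability_mx (A z) (b z) i j)}.
  apply: (pointwise_reachability_mx Qc) => *; exact: within_continuous_entry.
have bS i j : exists K, forall z, P z ->
    normc (reachability_mx (A z) (b z) i j) <= K.
  exact: (within_continuous_bounded cP (cS i j)).
have [K KP] := choice (fun ij : 'I_n * 'I_n => bS ij.1 ij.2).
exists (\sum_i \sum_j K (i, j) * NM (delta_mx i j)) => _ [z Pz <-].
by apply: (is_norm_mx_le NN) => i j; exact: (KP (i, j)).
Qed.

(** * Assembly of the error estimate and of the Lipschitz claim *)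

Unset Implicit Arguments.
Set Strict Implicit.

Theorem theorem8 (R : realType) (n : nat) (n_gt0 : (0 < n)%N)
    (norm : 'cV[R[i]]_n -> R) (normM : 'M[R[i]]_n -> R)
    (norm_norm : is_norm norm)
    (norm_le_max :
       forall v, norm v <= \big[Num.max/0]_(k < n) normc (v k ord0))
    (normM_norm : is_norm normM)
    (normM_sub : forall X v, norm (X *m v) <= normM X * norm v)
    (P : set R[i]) (P_arc : jordan_arc P)
    (A : R[i] -> 'M[R[i]]_n) (b : R[i] -> 'cV[R[i]]_n)
    (A_cont : {within P, continuous A})
    (b_cont : {within P, continuous b})
    (N1 : forall theta, P theta -> reachable (A theta) (b theta))
    (N2 : forall theta theta', P theta -> P theta' -> theta <> theta' ->
       spectrum (A theta) `&` spectrum (A theta') = set0)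
    (a : nat -> R[i]) (a0 : R[i] -> R[i])
    (a0_cont : {within P, continuous a0})
    (S1 : forall theta, P theta ->
       char_poly (A theta) =
       'X^n - (\sum_(1 <= i < n) a i *: 'X^i + (a0 theta)%:P))
    (al ar : R)
    (a0_image : a0 @` P = [set x%:C | x in `[al, ar]])
    (f : R[i] -> 'cV[R[i]]_n) (f_cont : {within P, continuous f}) :
  let S := fun theta => reachability_mx (A theta) (b theta) in
  let g := fun (k : 'I_n) (z : R[i]) =>
    (invmx (S (pinv P a0 z)) *m f (pinv P a0 z)) k ord0 in
  (forall (eps : R) (L : 'I_n -> R) (deg : 'I_n -> nat)
          (N : nat) (alpha : nat -> R[i]),
     0 < eps ->
     (forall k, 0 < L k /\ lipschitz_with normc (a0 @` P) (g k) (L k)) ->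
     (forall k, (3 <= deg k)%N) ->
     (forall k,
        Num.sqrt 2 *
        (4 * sup_norm normc (a0 @` P) (g k) + (ar - al) * L k / 2) *
        Num.sqrt (ln (deg k)%:R / (deg k)%:R)
        < eps / sup_norm normM P S) ->
     \sum_(k < n)
        (bernstein al ar (fun x => g k x%:C) (deg k)
           \Po ('X^n - \sum_(1 <= i < n) a i *: 'X^i)) * 'X^k
       = \sum_(l < N.+1) alpha l *: 'X^l ->
     sup_norm norm P
       (fun theta =>
          solution A b N.+1 (fun t => alpha (N - t)%N) (fun=> 0) theta
          - f theta) < eps)
  /\
  (C1_on P A -> C1_on P b -> Lip norm P f ->
   (forall theta, P theta -> forall d,
      has_derivative_on P a0 theta d -> d <> 0) ->
   forall k, Lip normc (a0 @` P) (g k)).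

Proof.
case: n n_gt0 norm normM norm_norm norm_le_max normM_norm normM_sub A b A_cont
  b_cont N1 N2 S1 f f_cont => // n' n_gt0 norm normM norm_norm norm_le_max
  normM_norm normM_sub A b A_cont b_cont N1 N2 S1 f f_cont S g.
have cP := jordan_arc_compact P_arc.
have a0_inj z w : P z -> P w -> a0 z = a0 w -> z = w.
  move=> Pz Pw zw; apply: contrapT => /(N2 _ _ Pz Pw) dis.
  have /char_poly_eq_spectrum_meet : char_poly (A z) = char_poly (A w).
    by rewrite (S1 z Pz) (S1 w Pw) zw.
  by rewrite dis => -[].
have pinvE z : P z -> pinv P a0 (a0 z) = z.
  move=> Pz; apply: pinvKV; last by rewrite inE.
  by move=> u v; rewrite !inE; exact: a0_inj.
have gE z k : P z -> g k (a0 z) = (invmx (S z) *m f z) k ord0.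
  by move=> Pz; rewrite /g pinvE.
have a0_real z : P z -> exists2 x, al <= x <= ar & a0 z = x%:C.
  move=> Pz; have : (a0 @` P) (a0 z) by exists z.
  by rewrite a0_image => -[x]; rewrite /= in_itv /= => xI <-; exists x.
have im_real x : al <= x <= ar -> (a0 @` P) x%:C.
  by move=> xI; rewrite a0_image; exists x => //=; rewrite in_itv.
(* Two distinct points of the arc make [al, ar] nondegenerate, by injectivity of a_0, and P nonempty
   for the final supremum. *)
have [z1 [z2 [Pz1 Pz2 z12]]] : exists z1 z2, [/\ P z1, P z2 & z1 <> z2].
  have [c [d [h [h' [cd hP hK _ _]]]]] := P_arc.
  have cI : c \in `[c, d] by rewrite in_itv /= lexx ltW.
  have dI : d \in `[c, d] by rewrite in_itv /= lexx ltW.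
  exists (h c), (h d); split; rewrite -?hP; [by exists c|by exists d|].
  by move=> hcd; move: cd; rewrite -(hK c cI) hcd (hK d dI) ltxx.
have alr : al < ar.
  have [x1 /andP[lx1 x1r] z1x] := a0_real z1 Pz1.
  have [x2 /andP[lx2 x2r] z2x] := a0_real z2 Pz2.
  rewrite lt_neqAle (le_trans lx1 x1r) andbT; apply/eqP => alar.
  apply: z12; apply: a0_inj => //; rewrite z1x z2x; congr (_%:C).
  by apply/eqP; rewrite eq_le; apply/andP; split; lra.
split; last first.
  move=> C1A C1b fL a0d k.
  have a0det z : P z -> a0 z = (-1) ^+ n'.+2 * \det (A z).
    by move=> Pz; exact: char_poly_constant_coef (S1 z Pz).
  have a0Re z : P z -> a0 z = (complex.Re (a0 z))%:C.
    by move=> /a0_real[x _ ->].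
  have [K KP] := reachable_coordinates_Lip n_gt0 norm_norm normM_sub P_arc
    A_cont b_cont f_cont N1 a0det a0_inj a0Re C1A C1b fL a0d k.
  (* [Lip] asks for a positive constant, and [K] may have any sign. *)
  exists (Num.max K 1); first by rewrite lt_max ltr01 orbT.
  move=> _ _ [z Pz <-] [w Pw <-]; rewrite (gE z k Pz) (gE w k Pw).
  apply: le_trans (KP w z Pw Pz) _.
  by apply: ler_wpM2r; rewrite ?normc_ge0 // le_max lexx.
move=> eps L deg N alpha eps0 gL deg3 rate palpha.
set sS := sup_norm normM P S in rate.
have S_ub := has_ubound_norm_reachability_mx normM_norm cP A_cont b_cont.
have S_le z : P z -> normM (S z) <= sS.
  by move=> Pz; apply: ub_le_sup => //; exists z.
have M0 k : 0 <= sup_norm normc (a0 @` P) (g k).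
  by apply: sup_norm_ge0 => v; exact: normc_ge0.
have D0 k : 0 <= (ar - al) * L k.
  by rewrite mulr_ge0 ?subr_ge0 ?ltW //; case: (gL k).
pose E k := Num.sqrt 2 *
  (4 * sup_norm normc (a0 @` P) (g k) + (ar - al) * L k / 2) *
  Num.sqrt (ln (deg k)%:R / (deg k)%:R).
have E0 k : 0 <= E k.
  apply: mulr_ge0; last exact: sqrtr_ge0.
  apply: mulr_ge0; first exact: sqrtr_ge0.
  by apply: addr_ge0; [exact: mulr_ge0 (M0 k)|exact: divr_ge0 (D0 k) _].
have epsS : 0 < eps / sS by apply: le_lt_trans (E0 ord0) (rate ord0).
(* Division by zero yields 0, so the rate condition itself, whose left side is nonnegative, excludes
   [sS] = 0. *)
have sS0 : 0 < sS.
  have : 0 <= sS by apply: sup_norm_ge0 => v; exact: is_norm_ge0 normM_norm.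
  rewrite le_eqVlt => /predU1P[sS0|//].
  by move: epsS; rewrite -sS0 invr0 mulr0 ltxx.
(* A pointwise strict bound would give only <= eps for the supremum; the finite maximum [delta]
   leaves a uniform gap below eps. *)
pose delta := \big[Num.max/0]_k E k.
have delta_lt : delta < eps / sS by apply: bigmax_lt => // k _; exact: rate.
suff err z : P z -> norm (solution A b N.+1 (fun t => alpha (N - t)%N)
    (fun=> 0) z - f z) <= sS * delta.
  apply: (@le_lt_trans _ _ (sS * delta)); last by rewrite mulrC -ltr_pdivlMr.
  by apply: ge_sup => [|_ [z Pz <-]]; [eexists; exists z1|exact: err].
move=> Pz; have [x xI zx] := a0_real z Pz.
have SU : S z \in unitmx by apply: reachability_mx_unit; exact: N1.
have charE : char_poly (A z) =
    ('X^(n'.+1) - \sum_(1 <= i < n'.+1) a i *: 'X^i) - (a0 z)%:P.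
  by rewrite S1 // opprD addrA.
rewrite solution_horner_mx -palpha (horner_mx_reachability _ _ charE).
rewrite -[f z](mulKVmx SU) -mulmxBr.
apply: le_trans (normM_sub _ _) _; apply: ler_pM.
- exact: is_norm_ge0 normM_norm.
- exact: is_norm_ge0 norm_norm.
- exact: S_le.
(* Domination by the maximum of the coordinates lets each Bernstein error be estimated alone,
   without summing over k. *)
apply: le_trans (norm_le_max _) _; apply: bigmax_le => [|k _].
  exact: bigmax_ge_id.
apply: le_trans (le_bigmax_cond _ _ (erefl true : predT k)).
rewrite mxE [X in X + _]mxE [X in _ + X]mxE -(gE z k Pz) zx.
have gLx y y' : al <= y <= ar -> al <= y' <= ar ->
    normc (g k y%:C - g k y'%:C) <= L k * `|y - y'|.
  move=> yI y'I; have [_ gLk] := gL k.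
  apply: le_trans (gLk _ _ (im_real y yI) (im_real y' y'I)) _.
  by rewrite -rmorphB normc_real.
have degk0 : (0 < deg k)%N by apply: leq_trans (deg3 k).
apply: le_trans (bernstein_approx (g := fun x => g k x%:C) alr degk0 gLx xI) _.
exact: bernstein_rate.
Qed.
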